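(* Let $m$ be a positive integer, let $f:\mathbb{Z}_{\geq 0}\to\mathbb{Z}_{\geq 0}$ be an increasing function such that $$f(i+1)\geq (m+1)f(i)\quad\text{for all } i>0,$$ and let $d\in\mathbb{Z}_{\geq 0}$. If $$(m+1)f(i+1)\leq A(d,\,f(i)-1)\quad\text{for all } i>0,$$ then $$L_{f,m} < \big\lceil f^{-1}\big(A(m+d,(m+1)f(1)-1)\big)\big\rceil.$$
   Context: The Ackermann function $A:\mathbb{Z}_{\geq 0}\times\mathbb{Z}_{\geq 0}\to\mathbb{Z}_{\geq 0}$ is defined by $A(0,n)=n+1$, $A(m+1,0)=A(m,1)$, $A(m+1,n+1)=A(m,A(m+1,n))$ for $m,n\geq 0$. The expressions $A(\cdot,\cdot)$ in the hypotheses and conclusion are understood to be defined, i.e. their arguments are nonnegative integers (in particular $f(i)-1\ge 0$ for $i>0$). ''Increasing'' means $f(i)\leq f(j)$ whenever $i\leq j$. For real $x$, $\lceil f^{-1}(x)\rceil$ denotes the least nonnegative integer $k$ such that $f(k)\geq x$. A sequence $\tau_1,\dots,\tau_k$ of $m$-tuples of nonnegative integers is Dicksonian if $\tau_i\nleq\tau_j$ for all $i<j$, where $\leq$ is the product (coordinatewise) order on $\mathbb{Z}_{\geq 0}^m$. Writing $\tau_i=(\tau_1^i,\dots,\tau_m^i)$, the max growth of the sequence is bounded by $f$ if $\max\{\tau_1^i,\dots,\tau_m^i\}\leq f(i)$ for all $1\leq i\leq k$. $L_{f,m}$ denotes the maximal length of a Dicksonian sequence of $m$-tuples of nonnegative integers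 whose max growth is bounded by $f$. *)

(* Defs.v *)
From mathcomp Require Import all_boot all_order.

Set Implicit Arguments.
Unset Strict Implicit.
Unset Printing Implicit Defensive.

Fixpoint ack (m : nat) : nat -> nat :=
  if m is m'.+1 then
    fix ack_m n := if n is n'.+1 then ack m' (ack_m n') else ack m' 1
  else succn.

Fact ack0n n : ack 0 n = n.+1. Proof. by []. Qed.
Fact ackS0 m : ack m.+1 0 = ack m 1. Proof. by []. Qed.
Fact ackSS m n : ack m.+1 n.+1 = ack m (ack m.+1 n). Proof. by []. Qed.

(* The order of m.-tupleprod nat is the coordinatewise one, see leEtprod. *)
Definition Dicksonian (m k : nat) (tau : 'I_k -> m.-tupleprod nat) : Prop :=
  forall i j : 'I_k, i < j -> ~~ (tau i <= tau j)%O.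

(* Sequences are numbered from 1 in the mathematics, but 'I_k starts at 0: the
   term tau i is the (i + 1)-st one, hence is bounded by f i.+1. *)
Definition max_growth_bounded (f : nat -> nat) (m k : nat)
    (tau : 'I_k -> m.-tupleprod nat) : Prop :=
  forall i : 'I_k, \max_(l < m) tnth (tau i) l <= f i.+1.

Definition Dicksonian_length (f : nat -> nat) (m k : nat) : Prop :=
  exists tau : 'I_k -> m.-tupleprod nat,
    Dicksonian tau /\ max_growth_bounded f tau.

(* L = L_{f,m} *)
Definition is_max_Dicksonian_length (f : nat -> nat) (m L : nat) : Prop :=
  Dicksonian_length f m L /\ forall k, Dicksonian_length f m k -> k <= L.

(* k is the ceiling of f^-1(x) *)
Definition is_ceil_inv (f : nat -> nat) (x k : nat) : Prop :=
  x <= f k /\ forall j, x <= f j -> k <= j.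

(* Main.v *)
Require Import Defs.
From mathcomp Require Import all_boot all_order.
From mathcomp Require Import zify.
From Stdlib Require Import Classical.

(** Call pattern a vector of length m in which every coordinate is either fixed
    to a value or free; its dimension is the number of its free coordinates.
    At any time a Dicksonian sequence is confined to a finite list of patterns,
    at the start to the single pattern with all coordinates free.  If the term
    [x] played at time [t] lies in a pattern [p] of dimension k, then a later
    term [y] in [p] does not dominate [x], so it has [y l < x l] at some
    coordinate [l], free in [p] because [x] and [y] agree on the fixed ones.
    Hence [p] can be traded for the patterns that fix in addition one free
    coordinate [l] to some value below [x l]: these are at most k * g t patterns
    of dimension k - 1, where [g] bounds the growth.  The length of the sequence
    is therefore at most the duration of a game on the numbers of patterns of
    each dimension.

    The game lasts longest when a pattern of the lowest available dimension is
    always spent first.  For this strategy, a game begun at time [t] with one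
    pattern of dimension k ends at the time [exhaust g k t], given by a nested
    iteration, and [exhaust_all] is the end of the game for an arbitrary list of
    patterns.  Lemma [exhaust_all_spend] is the key: no move increases this
    potential, because postponing a move on a high dimension to a later time
    pays off at least as many patterns as were spent meanwhile, [g] being
    strictly increasing.

    Finally, a nested iteration is what the Ackermann recursion computes: if one
    step of [g] is bounded by level d of the Ackermann function, each dimension
    raises the level by one ([growth_exhaust]).  The bound for dimension k has
    (k + 1) * g t - 1 as argument, and the factor m + 1 in the hypothesis on the
    steps of [g] is there so that this argument can be fed with the previous
    value in the iteration.  A sequence of length L ends by the time
    [exhaust g m 0], at which [g], even multiplied by m + 1, is still bounded by
    level m + d: so the value of the growth function at L is less than that. *)

Set Implicit Arguments.
Unset Strict Implicit.
Unset Printing Implicit Defensive.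

(** * Monotonicity of the Ackermann function *)

Lemma ack_gt d n : n < ack d n.
Proof.
elim: d n => [|d IHd] n; first by rewrite ack0n.
elim: n => [|n IHn]; first by rewrite ackS0; exact: leq_ltn_trans (IHd 1).
by rewrite ackSS; exact: leq_ltn_trans IHn (IHd _).
Qed.

Lemma ack_homo d : {homo ack d : a b / a <= b}.
Proof.
apply: homo_leq => [//|b a c|n]; first exact: leq_trans.
case: d => [|d]; first by rewrite !ack0n.
by rewrite ackSS; apply: ltnW; exact: ack_gt.
Qed.

Lemma ack_leS d n : ack d n <= ack d.+1 n.
Proof.
case: n => [|n]; first by rewrite ackS0; exact: ack_homo.
by rewrite ackSS; apply: ack_homo; exact: ack_gt.
Qed.

Lemma ack_leD d k n : ack d n <= ack (d + k) n.
Proof.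
elim: k => [|k IHk]; first by rewrite addn0.
by rewrite addnS; exact: leq_trans IHk (ack_leS _ _).
Qed.

(** * The game on dimensions *)

Lemma leq_iter (F : nat -> nat) a b s t :
    {homo F : x y / x <= y} -> (forall x, x <= F x) ->
  a <= b -> s <= t -> iter a F s <= iter b F t.
Proof.
move=> homoF geF; elim: b a => [|b IHb] [|a] //= le_ab le_st.
  by apply: leq_trans (geF _); exact: (IHb 0).
by apply: homoF; exact: IHb.
Qed.

Lemma iter_ge (F : nat -> nat) n t :
  (forall x, x < F x) -> t + n <= iter n F t.
Proof.
move=> gtF; elim: n => [|n IHn] /=; first by rewrite addn0.
by rewrite addnS; exact: leq_ltn_trans IHn (gtF _).
Qed.

(** The end of the game begun at time [t] with one pattern of dimension [k],
    when the lowest dimension is always played first: the first move turns the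
    pattern into [k * g t] patterns of dimension [k - 1], which are then used up
    one after the other. *)
Fixpoint exhaust (g : nat -> nat) (k t : nat) : nat :=
  if k is k'.+1 then iter (k * g t) (exhaust g k') t.+1 else t.+1.

(** The same with [c j] patterns of each dimension [j < k]. *)
Fixpoint exhaust_all (g : nat -> nat) (k : nat) (c : nat -> nat) (t : nat) :=
  if k is k'.+1 then iter (c k') (exhaust g k') (exhaust_all g k' c t) else t.

Section Game.

Variable g : nat -> nat.
Hypothesis g_gt0 : forall t, 0 < g t.
Hypothesis g_ltn : {homo g : s t / s < t}.

Lemma growth_leq : {homo g : s t / s <= t}.
Proof. exact: ltnW_homo g_ltn. Qed.

Lemma growth_sub s t : s <= t -> g s + (t - s) <= g t.
Proof.
move=> /subnKC <-; elim: (t - s) => [|n]; first by rewrite addn0 subnn addn0.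
have := g_ltn (ltnSn (s + n)); rewrite addnS; lia.
Qed.

Lemma exhaust_gt k t : t < exhaust g k t.
Proof.
elim: k t => [|k IHk] t //=.
by apply: leq_trans (iter_ge _ _ IHk); exact: leq_addr.
Qed.

Lemma exhaust_ge k t : t <= exhaust g k t.
Proof. exact/ltnW/exhaust_gt. Qed.

Lemma exhaust_homo k : {homo exhaust g k : s t / s <= t}.
Proof.
elim: k => [|k IHk] s t le_st //=.
by apply: leq_iter IHk (exhaust_ge k) _ _ => //; rewrite leq_mul2l growth_leq.
Qed.

Lemma exhaust_leS k t : exhaust g k t <= exhaust g k.+1 t.
Proof.
rewrite [leqRHS]/=.
apply: (@leq_iter _ 1 _ _ _ (@exhaust_homo k) (exhaust_ge k)) => //.
by rewrite muln_gt0 g_gt0.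
Qed.

Lemma exhaust_all_homo k (c c' : nat -> nat) s t :
    (forall j, j < k -> c j <= c' j) -> s <= t ->
  exhaust_all g k c s <= exhaust_all g k c' t.
Proof.
elim: k => [|k IHk] //= le_c le_st.
apply: leq_iter (@exhaust_homo k) (exhaust_ge k) _ _; first exact: le_c.
by apply: IHk => // j lt_jk; apply: le_c; exact: ltnW.
Qed.

Lemma exhaust_all_idle k (c : nat -> nat) t :
  (forall j, j < k -> c j = 0) -> exhaust_all g k c t = t.
Proof.
elim: k => [|k IHk] //= c0; rewrite c0 //=.
by apply: IHk => j lt_jk; apply: c0; exact: ltnW.
Qed.

Lemma exhaust_all_ge k (c : nat -> nat) t :
  t + \sum_(j < k) c j <= exhaust_all g k c t.
Proof.
elim: k => [|k IHk] /=; first by rewrite big_ord0 addn0.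
rewrite big_ord_recr /= addnA.
by apply: leq_trans (iter_ge _ _ (exhaust_gt k)); rewrite leq_add2r.
Qed.

(** Replacing every pattern by one of the top dimension prolongs the game. *)
Lemma exhaust_all_le k (c : nat -> nat) t :
  exhaust_all g k.+1 c t <= iter (\sum_(j < k.+1) c j) (exhaust g k) t.
Proof.
elim: k => [|k IHk]; first by rewrite big_ord_recr big_ord0.
rewrite big_ord_recr [X in iter X _ _]addnC iterD.
apply: leq_iter (@exhaust_homo k.+1) (exhaust_ge k.+1) (leqnn _) _.
apply: leq_trans IHk _; elim: (\sum_(_ < _) _) => //= n IHn.
by apply: leq_trans (exhaust_leS _ _); exact: exhaust_homo.
Qed.

(** A move on dimension [k] does not increase the potential.  Only the
    dimensions up to [k] matter, since the higher ones act by monotone maps.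
    The lowest-first strategy plays the same move at the time [u] when the [n]
    patterns of dimension less than [k] are used up; since [u >= t + n], it then
    gets [k * g u >= k * g t + n] patterns of dimension [k - 1], which outlast
    both the [k * g t] new patterns and the [n] old ones. *)
Lemma exhaust_all_spend K k (c c' : nat -> nat) t :
    k < K ->
    (forall j, c' j + (j == k) <= c j + (j.+1 == k) * (k * g t)) ->
  exhaust_all g K c' t.+1 <= exhaust_all g K c t.
Proof.
move=> lt_kK le_c'; elim: K lt_kK => [//|K IHK].
rewrite ltnS leq_eqVlt => /predU1P[defk | lt_kK] /=; last first.
  apply: leq_iter (@exhaust_homo K) (exhaust_ge K) _ (IHK lt_kK).
  by have := le_c' K; rewrite (gtn_eqF lt_kK) (gtn_eqF (leqW lt_kK)) /= mul0n !addn0.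
rewrite -{}defk {IHK K}.
have le_spent : (c' k).+1 <= c k.
  by have := le_c' k; rewrite eqxx gtn_eqF //= addn1 addn0.
apply: leq_trans (leq_iter (@exhaust_homo k) (exhaust_ge k) le_spent (leqnn _)).
rewrite iterSr.
apply: leq_iter (@exhaust_homo k) (exhaust_ge k) (leqnn _) _.
case: k le_c' {le_spent} => [//|k] le_c'.
apply: leq_trans (exhaust_all_le k c' t.+1) _.
set u := exhaust_all g k.+1 c t; rewrite [leqRHS]/=.
have := exhaust_all_ge k.+1 c t; rewrite -/u => le_u.
have le_tu : t <= u by apply: leq_trans le_u; exact: leq_addr.
apply: leq_iter (@exhaust_homo k) (exhaust_ge k) _ _ => //.
have le_sum : \sum_(j < k.+1) c' j <= \sum_(j < k.+1) c j + k.+1 * g t.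
  rewrite !big_ord_recr /= -addnA; apply: leq_add; last first.
    by have := le_c' k; rewrite eqxx mul1n ltn_eqF // addn0.
  apply: leq_sum => j _; have := le_c' j.
  by rewrite eqSS (ltn_eqF (ltn_ord j)) (ltn_eqF (leqW (ltn_ord j))) mul0n !addn0.
apply: leq_trans le_sum _; have := growth_sub le_tu; nia.
Qed.

(** By definition [exhaust g k.+1] iterates [exhaust g k] for [k.+1 * g t] times.
    Each iteration is one application of the level [d + k] of the Ackermann
    function, hence adds 1 to the argument at the level [d + k.+1]; starting from
    the argument [g t - 1], this leads to [k.+2 * g t - 1]. *)
Lemma growth_exhaust m d k t :
    (forall s, (m + 1) * g s.+1 <= ack d (g s - 1)) -> k <= m ->
  (m + 1) * g (exhaust g k t) <= ack (d + k) (k.+1 * g t - 1).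
Proof.
move=> g_ack; elim: k t => [|k IHk] t le_km.
  by rewrite addn0 mul1n; exact: g_ack.
(* The factor [m + 1] on the left pays for the factor [k.+1] in the argument
   of [IHk] when the iteration is continued. *)
have iter_bound n : (m + 1) * g (iter n (exhaust g k) t.+1)
    <= ack (d + k.+1) (g t - 1 + n).
  elim: n => [|n IHn]; first by rewrite addn0; exact: leq_trans (g_ack t) (ack_leD _ _ _).
  rewrite iterS [g t - 1 + _]addnS [d + k.+1]addnS ackSS -[(d + k).+1]addnS.
  apply: leq_trans (IHk _ (ltnW le_km)) _; apply: ack_homo.
  by apply: leq_trans (leq_subr _ _) _; apply: leq_trans IHn; nia.
apply: leq_trans (iter_bound _) _; apply: ack_homo.
by have := g_gt0 t; nia.
Qed.

End Game.

(** * Patterns confining a Dicksonian sequence *)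

Section Patterns.

Variable m : nat.
Implicit Types (p : {ffun 'I_m -> option nat}) (x y : 'I_m -> nat).

Definition free p := [pred l | p l == None].

Definition dim p := #|free p|.

Definition matches x p := [forall l, (p l == None) || (p l == Some (x l))].

Definition fix_coord p l v : {ffun 'I_m -> option nat} :=
  [ffun l' => if l' == l then Some v else p l'].

Definition refine p x :=
  [seq fix_coord p l v | l <- enum (free p), v <- iota 0 (x l)].

Lemma dim_fix_coord p l v : l \in free p -> (dim (fix_coord p l v)).+1 = dim p.
Proof.
move=> free_l; rewrite /dim (cardD1 l (free p)) free_l add1n; congr _.+1.
by apply: eq_card => l'; rewrite !inE ffunE; case: (l' == l).
Qed.

(** A term [y] of the pattern which does not dominate [x] is below [x] at some
    coordinate, and that coordinate cannot be a fixed one. *)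
Lemma matches_refine p x y :
    matches x p -> matches y p -> ~~ [forall l, x l <= y l] ->
  has (matches y) (refine p x).
Proof.
move=> /forallP px /forallP py /forallPn[l]; rewrite -ltnNge => lt_yx.
have free_l : p l == None.
  case/orP: (px l) (py l) => [//|/eqP->] /= /eqP[eq_xy].
  by rewrite eq_xy ltnn in lt_yx.
apply/hasP; exists (fix_coord p l (y l)).
  apply/allpairsPdep; exists l, (y l).
  by rewrite mem_enum mem_iota add0n inE.
apply/forallP=> l'; rewrite ffunE; have [->|_] := eqVneq l' l; last exact: py.
by rewrite eqxx.
Qed.

Lemma size_refine p x b : (forall l, x l <= b) -> size (refine p x) <= dim p * b.
Proof.
move=> le_xb; rewrite /refine size_allpairs_dep sumnE big_map.
rewrite (eq_bigr x) => [|l _]; last by rewrite size_iota.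
rewrite big_enum /= /dim -sum_nat_const.
by apply: leq_sum => l _; exact: le_xb.
Qed.

Lemma count_refine p x j :
  count (fun q => dim q == j) (refine p x)
    <= (j.+1 == dim p) * size (refine p x).
Proof.
case: eqP => [_|ne_jp]; first by rewrite mul1n count_size.
rewrite mul0n leqn0 eqn0Ngt -has_count; apply/hasPn => q.
case/allpairsPdep=> l [v [free_l _ ->]]; rewrite mem_enum in free_l.
by apply/eqP => dim_q; apply: ne_jp; rewrite -dim_q (dim_fix_coord v free_l).
Qed.

(** The terms from time [t] on are confined to the patterns of [P], and each
    further term is one move of the game. *)
Lemma bad_sequence_length (g : nat -> nat) k (u : 'I_k -> 'I_m -> nat) t P :
    (forall s, 0 < g s) -> {homo g : r s / r < s} ->
    (forall i j : 'I_k, i < j -> ~~ [forall l, u i l <= u j l]) ->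
    (forall (i : 'I_k) l, u i l <= g i) ->
    t <= k -> (forall i : 'I_k, t <= i -> has (matches (u i)) P) ->
  k <= exhaust_all g m.+1 (fun j => count (fun p => dim p == j) P) t.
Proof.
move=> g_gt0 g_ltn bad_u u_le /subnKC.
move: (k - t) => n; elim: n t P => [|n IHn] t P def_k match_P.
  rewrite -[X in X <= _]def_k addn0.
  by apply: leq_trans (exhaust_all_ge _ _ _ _) => //; exact: leq_addr.
have lt_tk : t < k by rewrite -def_k addnS ltnS leq_addr.
pose i0 := Ordinal lt_tk; have /hasP[p Pp match_p] := match_P i0 (leqnn t).
pose P' := refine p (u i0) ++ rem p P.
have match_P' (i : 'I_k) : t < i -> has (matches (u i)) P'.
  move=> lt_ti; rewrite has_cat; apply/orP.
  have /hasP[q Pq match_q] := match_P i (ltnW lt_ti).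
  have [eq_qp|ne_qp] := eqVneq q p.
    by left; apply: matches_refine (bad_u i0 i lt_ti) => //; rewrite -eq_qp.
  right; apply/hasP; exists q => //.
  by move: Pq; rewrite (perm_mem (perm_to_rem Pp)) inE (negPf ne_qp).
apply: leq_trans (IHn t.+1 P' _ match_P') _; first by rewrite addSnnS.
apply: (exhaust_all_spend g_gt0 g_ltn (k := dim p)) => [|j].
  by rewrite ltnS -[X in _ <= X](card_ord m) max_card.
rewrite count_cat (permP (perm_to_rem Pp)) /= [dim p == j]eq_sym.
have := count_refine p (u i0) j; have := size_refine p (u_le i0) => /=.
by case: (j.+1 == dim p); lia.
Qed.

End Patterns.

(** * Lengths of Dicksonian sequences *)

Lemma Dicksonian_length_bound (f : nat -> nat) m k :
    (forall t, 0 < f t.+1) -> {homo (fun t => f t.+1) : s t / s < t} ->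
  Dicksonian_length f m k -> k <= exhaust (fun t => f t.+1) m 0.
Proof.
move=> f_gt0 f_ltn [tau [bad_tau tau_le]].
pose P := [:: [ffun _ : 'I_m => @None nat]].
have dimP : dim [ffun _ : 'I_m => @None nat] = m.
  by rewrite -[RHS](card_ord m); apply: eq_card => l; rewrite !inE ffunE.
have := @bad_sequence_length m (fun t => f t.+1) k (fun i => tnth (tau i)) 0 P
  f_gt0 f_ltn.
rewrite /= dimP eqxx /= exhaust_all_idle => [|j lt_jm]; last by rewrite gtn_eqF.
apply=> // [i j lt_ij|i l|i _].
- by have := bad_tau i j lt_ij; rewrite Order.TupleProdOrder.leEtprod.
- exact: leq_trans (leq_bigmax l) (tau_le i).
- by rewrite orbF; apply/forallP => l; rewrite ffunE.
Qed.

Lemma bounded_max (P : nat -> Prop) N :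
    P 0 -> (forall k, P k -> k <= N) ->
  exists L, P L /\ forall k, P k -> k <= L.
Proof.
move=> P0; elim: N => [|N IHN] leN; first by exists 0.
have [PN|nPN] := classic (P N.+1); first by exists N.+1.
apply: IHN => k Pk; have := leN k Pk; rewrite leq_eqVlt => /predU1P[eq_k|//].
by rewrite eq_k in Pk.
Qed.

Theorem lemma2p5 (m : nat) (f : nat -> nat) (d : nat)
  (m_gt0 : 0 < m)
  (f_incr : forall i j : nat, i <= j -> f i <= f j)
  (f_gt0 : forall i : nat, 0 < i -> 0 < f i)
  (f_growth : forall i : nat, 0 < i -> (m + 1) * f i <= f (i + 1))
  (f_ack : forall i : nat, 0 < i -> (m + 1) * f (i + 1) <= ack d (f i - 1)) :
  exists L K : nat,
    [/\ is_max_Dicksonian_length f m L,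
        is_ceil_inv f (ack (m + d) ((m + 1) * f 1 - 1)) K
      & L < K].
Proof.
(* Times are counted from 0, as the terms of a sequence are. *)
pose g t := f t.+1.
have g_gt0 t : 0 < g t by exact: f_gt0.
have g_ltn : {homo g : s t / s < t}.
  apply: homo_ltn => [b a c|t]; first exact: ltn_trans.
  by have := f_growth t.+1 isT; have := g_gt0 t; rewrite /g [t.+1 + 1]addn1; nia.
have g_ack t : (m + 1) * g t.+1 <= ack d (g t - 1).
  by have := f_ack t.+1 isT; rewrite [t.+1 + 1]addn1.
set X := ack _ _.
have [|L [L_len L_max]] := @bounded_max (Dicksonian_length f m) _ _
    (fun k => @Dicksonian_length_bound f m k g_gt0 g_ltn).
  have no_term (i : 'I_0) : m.-tupleprod nat by case: i.
  by exists no_term; split=> [[]|[]].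
have f_unbounded : exists k, X <= f k.
  exists X.+1; have := growth_sub g_ltn (leq0n X).
  by rewrite subn0; apply: leq_trans; exact: leq_addl.
pose K := ex_minn f_unbounded; exists L, K.
rewrite {}/K; case: ex_minnP => K le_XK K_min; split=> //.
rewrite ltnNge; apply/negP => le_KL.
suff lt_fL : f L < X.
  by have := leq_trans le_XK (f_incr _ _ le_KL); rewrite leqNgt lt_fL.
set T := exhaust g m 0.
have le_LT : L <= T by exact: Dicksonian_length_bound.
have := growth_exhaust g_gt0 0 g_ack (leqnn m).
rewrite -/T -[m.+1]addn1 [d + m]addnC -/X => le_X.
have := f_incr L T.+1 (leqW le_LT); rewrite -/(g T).
by have := g_gt0 T; nia.
Qed.
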